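(* Let $n\ge 1$. Define numbers $m^{\ell}_{A,k}$ for $1\le \ell\le n$, $A\subseteq[n]$ and $1\le k\le n+1$ by $m^1_{A,k}=1$ for all $(A,k)$ and, for $1<\ell\le n$, \[m^{\ell}_{A,k}=\sum_{B\subseteq A}\ \sum_{i=p(A,B,k)}^{q(A,B,k)} m^{\ell-1}_{B,i},\] where \[p(A,B,k)=\max\big(\{j\in[n+1]: j<k,\ j\notin A,\ j-1\in B\}\cup\{1\}\big),\quad q(A,B,k)=\min\big(\{j\in[n+1]: j>k,\ j\in B,\ j-1\notin A\}\cup\{n+1\}\big).\] Then the number $K(n)$ of maximum arrangements of nonattacking kings on the $2n\times 2n$ chessboard, i.e. the number of ways to place $n^2$ pairwise nonattacking kings on the $2n\times 2n$ board, equals \[K(n)=\sum_{A\subseteq[n]}\ \sum_{k=1}^{n+1} m^{n}_{A,k}.\]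
   Context: Two kings attack each other if their cells are distinct and adjacent horizontally, vertically or diagonally. The maximum number of pairwise nonattacking kings on a $2n\times 2n$ board is $n^2$; arrangements are counted as fixed placements (rotations and reflections are distinct). Here $[n]=\{1,\dots,n\}$ and $[n+1]=\{1,\dots,n+1\}$. *)

(* Defs.v *)
From mathcomp Require Import all_boot.

Set Implicit Arguments.
Unset Strict Implicit.
Unset Printing Implicit Defensive.

Section Kings.

Variable n : nat.

Definition cell : finType := ('I_(2 * n) * 'I_(2 * n))%type.

Definition attack (c d : cell) : bool :=
  [&& c != d,
      c.1 <= d.1 + 1, d.1 <= c.1 + 1,
      c.2 <= d.2 + 1 & d.2 <= c.2 + 1].

Definition nonattacking (S : {set cell}) : bool :=
  [forall c in S, forall d in S, ~~ attack c d].

(* Maximum arrangements, as fixed placements: n ^ 2 is the largest size of a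
   nonattacking set. *)
Definition K : nat := #|[set S : {set cell} | nonattacking S & #|S| == n ^ 2]|.

(* A subset of [n] = {1, ..., n} is encoded as A : {set 'I_n}, where the
   ordinal i stands for i + 1. All other indices (j, k, and the summation
   index i) are 1-based natural numbers, as in the usual notation; [has1 A j]
   is the membership of such a j in A. In particular it is false for j = 0
   and j = n + 1. *)
Definition has1 (A : {set 'I_n}) (j : nat) : bool :=
  [exists i in A, i.+1 == j].

(* The initial values 1 and n + 1 are the elements adjoined to the two sets. *)
Definition p (A B : {set 'I_n}) (k : nat) : nat :=
  \big[maxn/1]_(1 <= j < n.+2 | [&& j < k, ~~ has1 A j & has1 B (j - 1)]) j.

Definition q (A B : {set 'I_n}) (k : nat) : nat :=
  \big[minn/n.+1]_(1 <= j < n.+2 | [&& k < j, has1 B j & ~~ has1 A (j - 1)]) j.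

(* Only 1 <= l <= n and 1 <= k <= n + 1 are meaningful; m 0 is a dummy value. *)
Fixpoint m (l : nat) (A : {set 'I_n}) (k : nat) : nat :=
  match l with
  | (l'.+1 as l1).+1 =>
      \sum_(B : {set 'I_n} | B \subset A)
        \sum_(p A B k <= i < (q A B k).+1) m l1 B i
  | _ => 1
  end.

End Kings.

(* Main.v *)
Require Import Defs.
From mathcomp Require Import all_boot zify.

(* Cut the board into 2 x 2 blocks; a maximum arrangement has exactly one king in
   each. In a row of blocks no king in a right half is followed by one in a left
   half, so the horizontal positions are given by a threshold k, and going down
   a column of blocks no king in a lower half is followed by one in an upper
   half, so the sets A of upper kings decrease. The two diagonal adjacencies
   between consecutive rows (A, k) and (B, i) amount to p <= i <= q. Maximum
   arrangements are thus chains of n rows, and m l counts the chains of l rows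
   with a given first row. *)

(** * Tuples split at their head, and bounds on big minima and maxima *)

Lemma card_cons_tuple (T : finType) (P : pred (seq T)) (l : nat) :
  #|[set t : l.+1.-tuple T | P t]| =
  \sum_y #|[set t : l.-tuple T | P (y :: t)]|.
Proof.
rewrite -sum1_card.
rewrite (reindex (fun yt : T * l.-tuple T => [tuple of yt.1 :: yt.2])) /=; last first.
  exists (fun t : l.+1.-tuple T => (thead t, [tuple of behead t])) => t _ /=.
    by case: t => y t; rewrite theadE; congr pair; apply: val_inj.
  by rewrite -tuple_eta.
under [RHS]eq_bigr do rewrite -sum1_card.
by rewrite pair_big_dep /=; apply: eq_bigl => -[y t]; rewrite !inE.
Qed.

Lemma sorted_tupleP (l : nat) (T : Type) (e : rel T) (t : l.-tuple T) :
  reflect (forall r r' : 'I_l, r' = r.+1 :> nat -> e (tnth t r) (tnth t r')) (sorted e t).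
Proof.
case: l t => [|l] t; first by rewrite tuple0; left; case.
have x0 := thead t.
apply: (iffP (sortedP x0)) => [H r r' rr'|H i].
  by rewrite !(tnth_nth x0) rr'; apply: H; rewrite size_tuple -rr'.
rewrite size_tuple => il; have il' := ltnW il.
by have := H (Ordinal il') (Ordinal il) erefl; rewrite !(tnth_nth x0).
Qed.

Lemma leq_bigmin_seqP (I : eqType) (r : seq I) (P : pred I) (F : I -> nat) (b i : nat) :
  reflect (i <= b /\ forall j, j \in r -> P j -> i <= F j)
          (i <= \big[minn/b]_(j <- r | P j) F j).
Proof.
elim: r => [|x r IHr].
  by rewrite big_nil; apply: (iffP idP) => [|[]].
rewrite big_cons; case: ifPn => Px.
  rewrite leq_min; apply: (iffP andP) => [[ix /IHr[ib H]]|[ib H]].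
    by split=> // j; rewrite inE => /predU1P[->|/H].
  split; first by apply: H; rewrite ?mem_head.
  by apply/IHr; split=> // j jr; apply: H; rewrite inE jr orbT.
apply: (iffP IHr) => -[ib H]; split=> // j.
  by rewrite inE => /predU1P[->|/H//]; rewrite (negbTE Px).
by move=> jr; apply: H; rewrite inE jr orbT.
Qed.

Lemma bigmax_seq_leqP (I : eqType) (r : seq I) (P : pred I) (F : I -> nat) (b i : nat) :
  reflect (b <= i /\ forall j, j \in r -> P j -> F j <= i)
          (\big[maxn/b]_(j <- r | P j) F j <= i).
Proof.
elim: r => [|x r IHr].
  by rewrite big_nil; apply: (iffP idP) => [|[]].
rewrite big_cons; case: ifPn => Px.
  rewrite geq_max; apply: (iffP andP) => [[ix /IHr[ib H]]|[ib H]].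
    by split=> // j; rewrite inE => /predU1P[->|/H].
  split; first by apply: H; rewrite ?mem_head.
  by apply/IHr; split=> // j jr; apply: H; rewrite inE jr orbT.
apply: (iffP IHr) => -[ib H]; split=> // j.
  by rewrite inE => /predU1P[->|/H//]; rewrite (negbTE Px).
by move=> jr; apply: H; rewrite inE jr orbT.
Qed.

(** * Chains of row states and the numbers [m] *)

Section Chains.

Variable n : nat.
Implicit Types (A B : {set 'I_n}) (k i : 'I_n.+1) (c : 'I_n).

Lemma has1S A c : has1 A c.+1 = (c \in A).
Proof.
apply/existsP/idP => [[d /andP[dA /eqP[/val_inj <-]]]//|cA].
by exists c; rewrite cA eqxx.
Qed.

Lemma has1P A (j : nat) : reflect (exists2 c : 'I_n, c \in A & j = c.+1) (has1 A j).
Proof.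
apply: (iffP existsP) => [[c /andP[cA /eqP <-]]|[c cA ->]].
  by exists c.
by exists c; rewrite cA eqxx.
Qed.

(* [(A, k)] encodes a row of 2 x 2 blocks: [A] is the set of columns whose king
   is in the upper half of its block, and exactly the first [k] kings are in the
   left half. This [k] is one less than the paper's. *)
Definition row_state : finType := ({set 'I_n} * 'I_n.+1)%type.

(* [y] is the row of blocks just below [x]. *)
Definition step : rel row_state := fun x y =>
  (y.1 \subset x.1) && (p x.1 y.1 x.2.+1 <= y.2.+1 <= q x.1 y.1 x.2.+1).

Lemma p_leqP A B k i :
  reflect (forall c d : 'I_n, d = c.+1 :> nat -> d < k -> d \notin A -> c \in B -> d <= i)
          (p A B k.+1 <= i.+1).
Proof.
apply: (iffP (bigmax_seq_leqP _ _ _ _ _ _)) => [[_ H] c d dc dk dA cB|H].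
  have := H d.+1; rewrite mem_index_iota ltnS; apply; first by have := ltn_ord d; lia.
  by rewrite has1S dA subn1 /= dc has1S cB -dc ltnS dk.
split=> // j; rewrite mem_index_iota => jn /and3P[jk jA /has1P[c cB jc]].
(* The index [n.+1], which lies outside [A], is excluded by [j < k.+1]; so [j] names a column. *)
have jn' : j.-1 < n by have := ltn_ord k; lia.
have ej : j = (Ordinal jn').+1 by rewrite /=; lia.
rewrite {1}ej ltnS; apply: (H c _ _ _ _ cB) => /=; try lia.
by rewrite -has1S -ej.
Qed.

Lemma leq_qP A B k i :
  reflect (forall c d : 'I_n, d = c.+1 :> nat -> k < d -> c \notin A -> d \in B -> i <= d)
          (i.+1 <= q A B k.+1).
Proof.
apply: (iffP (leq_bigmin_seqP _ _ _ _ _ _)) => [[_ H] c d dc dk cA dB|H].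
  have := H d.+1; rewrite mem_index_iota ltnS; apply; first by have := ltn_ord d; lia.
  by rewrite has1S dB subn1 /= dc has1S cA -dc ltnS dk.
split=> // j; rewrite mem_index_iota => jn /and3P[kj /has1P[d dB jd] jA].
(* Since [k.+1 < j], [j] is at least 2 and [j - 1] names a column too. *)
have jn' : j.-2 < n by have := ltn_ord d; lia.
rewrite jd ltnS; apply: (H (Ordinal jn') d _ _ _ dB) => /=; try lia.
rewrite -has1S; suff -> : (Ordinal jn').+1 = j - 1 by [].
by rewrite /=; lia.
Qed.

Lemma big_nat1_ord (a b : nat) (F : nat -> nat) : 0 < a -> b <= n.+1 ->
  \sum_(a <= i < b.+1) F i = \sum_(i < n.+1 | a <= i.+1 <= b) F i.+1.
Proof.
move=> a0 bn; rewrite (big_nat_widen _ _ n.+2) // (big_nat_widenl _ 1) //.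
rewrite big_add1 big_mkord /=; apply: eq_bigl => i.
by rewrite ltnS andbC.
Qed.

(** The first row [x] stays outside the tuple; unfolding [m] once amounts to choosing the second
    row. *)
Lemma m_card (l : nat) (x : row_state) :
  m l.+1 x.1 x.2.+1 = #|[set t : l.-tuple row_state | path step x t]|.
Proof.
elim: l x => [|l IHl] [A k].
  rewrite (eq_card (_ : _ =i predT)) ?card_tuple // => t.
  by rewrite !inE tuple0.
rewrite card_cons_tuple (bigID (step (A, k))) /= [X in _ + X]big1 ?addn0; last first.
  by move=> y /negbTE ky; apply: eq_card0 => t; rewrite !inE /= ky.
rewrite [RHS](_ : _ = \sum_(y | step (A, k) y) m l.+1 y.1 y.2.+1); last first.
  by apply: eq_bigr => y ky; rewrite IHl; apply: eq_card => t; rewrite !inE /= ky.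
rewrite -(pair_big_dep (fun B => B \subset A)
   (fun B (i : 'I_n.+1) => p A B k.+1 <= i.+1 <= q A B k.+1)
   (fun B i => m l.+1 B i.+1)) /=.
apply: eq_bigr => B _; apply: big_nat1_ord.
  (* The adjoined values 1 and [n.+1] keep the range of [i] inside [[n+1]]. *)
  by rewrite lt0n -leqn0; apply/negP => /bigmax_seq_leqP[].
by have /leq_bigmin_seqP[] := leqnn (q A B k.+1).
Qed.

Lemma stepP (x y : row_state) :
  reflect [/\ y.1 \subset x.1,
      forall c d : 'I_n, d = c.+1 :> nat -> d < x.2 -> d \notin x.1 -> c \in y.1 -> d <= y.2
    & forall c d : 'I_n, d = c.+1 :> nat -> x.2 < d -> c \notin x.1 -> d \in y.1 -> y.2 <= d]
    (step x y).
Proof. by apply: (iffP and3P) => -[? /p_leqP ? /leq_qP ?]. Qed.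

(** * Kings in blocks: chains against nonattacking sets *)

Lemma block_coord_proof (r : 'I_n) (o : bool) : 2 * r + o < 2 * n.
Proof. by have := ltn_ord r; case: o; lia. Qed.

Definition block_coord r o := Ordinal (block_coord_proof r o).

Lemma half_proof (x : 'I_(2 * n)) : x./2 < n.
Proof. by have := ltn_ord x; lia. Qed.

Definition block_of (x : cell n) : 'I_n * 'I_n :=
  (Ordinal (half_proof x.1), Ordinal (half_proof x.2)).

Lemma block_ofK (x : cell n) :
  (block_coord (block_of x).1 (odd x.1), block_coord (block_of x).2 (odd x.2)) = x.
Proof. by case: x => x1 x2; congr pair; apply: val_inj => /=; lia. Qed.

(** First coordinates grow downwards: offset 1 means the lower half in the first coordinate, the
    right half in the second. *)
Definition king (t : n.-tuple row_state) (b : 'I_n * 'I_n) : cell n :=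
  (block_coord b.1 (b.2 \notin (tnth t b.1).1), block_coord b.2 ((tnth t b.1).2 <= b.2)).

Implicit Types t : n.-tuple row_state.

Lemma king_block t : cancel (king t) block_of.
Proof.
move=> [r c]; congr pair; apply: val_inj => /=.
  by case: (c \notin _); lia.
by case: (_ <= c); lia.
Qed.

Definition arrangement (t : n.-tuple row_state) : {set cell n} := king t @: setT.

Lemma card_arrangement t : #|arrangement t| = n ^ 2.
Proof.
by rewrite card_imset ?cardsT ?card_prod ?card_ord //; exact: can_inj (king_block t).
Qed.

Lemma attackC (c d : cell n) : attack c d = attack d c.
Proof. by rewrite /attack eq_sym; apply/and5P/and5P=> -[]. Qed.

Lemma nonattacking_arrangement t : sorted step t -> nonattacking (arrangement t).
Proof.
move=> /sorted_tupleP st; apply/forall_inP => _ /imsetP[b _ ->].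
apply/forall_inP => _ /imsetP[b' _ ->].
wlog: b b' / b.1 <= b'.1.
  by move=> H; case/orP: (leq_total b.1 b'.1) => /H //; rewrite attackC.
case: b b' => [r c] [r' c'] /= rr'; apply/and5P => -[/= ne].
move=> _ rle cle c'le.
have [er|ner] := eqVneq r r'.
  (* Within one row of blocks, an attack needs a right half followed by a left half, which a
     threshold forbids. *)
  subst r'; have cc' : c != c' by apply: contraNneq ne => ->.
  have {}cc' : nat_of_ord c <> c' by move/val_inj; apply/eqP.
  lia.
have er : r' = r.+1 :> nat.
  have : nat_of_ord r <> r' by move/val_inj; apply/eqP.
  by move: rle; case: (c \in _); case: (c' \in _) => /=; lia.
have /stepP[/subsetP sub pc qc] := st _ _ er.
(* Across two rows of blocks, an attack needs a lower half above an upper half. *)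
have /andP[cA c'B] : (c \notin (tnth t r).1) && (c' \in (tnth t r').1).
  by move: rle; case: (c \in _); case: (c' \in _) => /=; lia.
(* The king below is to the right, to the left or in the same column of blocks; each case
   contradicts one clause of [stepP]. *)
have [cc'|cc'|/val_inj cc'] := ltngtP c c'.
- have e : c' = c.+1 :> nat by lia.
  have /andP[kc c'k] : ((tnth t r).2 <= c) && (c' < (tnth t r').2).
    by move: c'le; case: (leqP (tnth t r).2 c); case: (leqP (tnth t r').2 c'); lia.
  suff : (tnth t r').2 <= c' by lia.
  by apply: qc e _ cA c'B; lia.
- have e : c = c'.+1 :> nat by lia.
  have /andP[kc c'k] : (c < (tnth t r).2) && ((tnth t r').2 <= c').
    by move: cle; case: (leqP (tnth t r).2 c); case: (leqP (tnth t r').2 c'); lia.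
  suff : c <= (tnth t r').2 by lia.
  by apply: pc e _ cA c'B; lia.
- by move: cA; rewrite cc' (sub _ c'B).
Qed.

(** A failing clause of [stepP] exhibits two attacking kings: in one column of blocks for the
    inclusion, in neighbouring columns for the other two. *)
Lemma sorted_arrangement t : nonattacking (arrangement t) -> sorted step t.
Proof.
move=> na; have {}na b b' : b != b' -> king t b != king t b' /\ ~~ attack (king t b) (king t b').
  move=> bb'; rewrite (can_eq (king_block t)); split=> //.
  have kS d : king t d \in arrangement t by apply: imset_f; rewrite inE.
  exact: (forall_inP (forall_inP na _ (kS b)) _ (kS b')).
apply/sorted_tupleP => r r' rr'.
have nb (c c' : 'I_n) : (r, c) != (r', c').
  by apply: contraTneq isT => -[/(congr1 val) /= e _]; lia.
apply/stepP; split.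
- apply/subsetP => c cB; apply/negPn/negP => cA.
  have [ne /negP[]] := na _ _ (nb c c); rewrite /attack ne /= cA cB /= rr'.
  by apply/and4P; split; case: ((tnth t r).2 <= c); case: ((tnth t r').2 <= c); lia.
- move=> c d dc dk dA cB; rewrite leqNgt; apply/negP => yd.
  have [ne /negP[]] := na _ _ (nb d c); rewrite /attack ne /= dA cB /= rr'.
  by apply/and4P; split; case: (leqP (tnth t r).2 d); case: (leqP (tnth t r').2 c); lia.
- move=> c d dc dk cA dB; rewrite leqNgt; apply/negP => yd.
  have [ne /negP[]] := na _ _ (nb c d); rewrite /attack ne /= cA dB /= rr'.
  by apply/and4P; split; case: (leqP (tnth t r).2 c); case: (leqP (tnth t r').2 d); lia.
Qed.

Lemma arrangement_inj : injective arrangement.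
Proof.
move=> t t' tt'.
have kk b : king t b = king t' b.
  have : king t b \in arrangement t' by rewrite -tt' imset_f ?inE.
  (* [block_of] identifies [b'] with [b], so both chains place the same king in block [b]. *)
  by case/imsetP => b' _ e; rewrite e -(king_block t b) e king_block.
apply: eq_from_tnth => r.
have kA c : (c \in (tnth t r).1) = (c \in (tnth t' r).1).
  have /(congr1 (fun x : cell n => val x.1)) /= := kk (r, c).
  by case: (c \in _); case: (c \in _) => //=; lia.
have kk2 (c : 'I_n) : ((tnth t r).2 <= c) = ((tnth t' r).2 <= c).
  by have /(congr1 (fun x : cell n => val x.2)) /= := kk (r, c); lia.
case: (tnth t r) (tnth t' r) kA kk2 => [A k] [A' k'] /= kA kk2.
congr pair; first exact/setP.
apply: val_inj; apply/eqP; rewrite /= eqn_leq.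
(* Test at [c = j]; if [j = n] there is no such column, but then [i <= j] anyway. *)
have key (i j : 'I_n.+1) : (forall c : 'I_n, (i <= c) = (j <= c)) -> i <= j.
  move=> ij; have [jn|] := ltnP j n; last by have := ltn_ord i; lia.
  by have := ij (Ordinal jn); rewrite /= leqnn => ->.
by rewrite !key.
Qed.

(** * Reading a chain off a maximum arrangement *)

Lemma threshold (b : 'I_n -> bool) :
    (forall c d : 'I_n, d = c.+1 :> nat -> b c -> b d) ->
  exists k : 'I_n.+1, forall c, b c = (k <= c).
Proof.
move=> b1.
have bmono (c d : 'I_n) : c <= d -> b c -> b d.
  case: d => d dn /=; elim: d dn => [|d IHd] dn.
    by rewrite leqn0 => /eqP c0; congr (is_true (b _)); apply: val_inj.
  rewrite leq_eqVlt => /predU1P[cd|cd bc].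
    by congr (is_true (b _)); apply: val_inj.
  by apply: (b1 (Ordinal (ltnW dn))) => //; apply: IHd.
pose P (k : 'I_n.+1) := [forall c : 'I_n, (k <= c) ==> b c].
(* The threshold [n] qualifies vacuously, so a least one exists. *)
have P0 : P ord_max by apply/forallP => c; rewrite /= leqNgt ltn_ord.
case: (arg_minnP (fun k : 'I_n.+1 => k : nat) P0) => k /forallP Pk kmin.
exists k => c; apply/idP/idP => [bc|]; last exact/implyP.
have := kmin (widen_ord (leqnSn n) c); apply; apply/forallP => d.
by apply/implyP => /= cd; apply: bmono bc.
Qed.

(** Two cells of a block attack each other, so [n ^ 2] kings must occupy all [n ^ 2] blocks, one
    each; their halves then define the chain. *)
Lemma arrangement_surj (S : {set cell n}) : nonattacking S -> #|S| = n ^ 2 ->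
  exists t, S = arrangement t.
Proof.
move=> na cS.
have naS x y : x \in S -> y \in S -> ~~ attack x y.
  by move=> xS yS; apply: (forall_inP (forall_inP na _ xS) _ yS).
have inj : {in S &, injective block_of}.
  move=> x y xS yS [/= e1 e2]; apply/eqP; apply: contraNT (naS _ _ xS yS) => xy.
  by rewrite /attack xy /=; lia.
have full : block_of @: S = setT.
  apply/eqP; rewrite eqEcard subsetT /= card_in_imset //.
  by rewrite cardsT card_prod card_ord cS mulnn.
have /fin_all_exists[f fP] b : exists x, x \in S /\ block_of x = b.
  have : b \in block_of @: S by rewrite full inE.
  by case/imsetP => x xS ->; exists x.
have fE b : f b = (block_coord b.1 (odd (f b).1), block_coord b.2 (odd (f b).2)).
  by rewrite -{1}[f b]block_ofK (fP b).2.
have fk r : exists k : 'I_n.+1, forall c, odd (f (r, c)).2 = (k <= c).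
  apply: threshold => c d dc oc; apply: contraNT (naS _ _ (fP (r, c)).1 (fP (r, d)).1) => od.
  rewrite (fE (r, c)) (fE (r, d)) /attack oc (negbTE od) /= dc xpair_eqE /=.
  rewrite -!val_eqE /=.
  by apply/and5P; split; try lia; case: odd; case: odd; lia.
have [k kP] := fin_all_exists fk.
pose t := [tuple ([set c | ~~ odd (f (r, c)).1], k r) | r < n].
(* The cardinals agree, so one inclusion suffices. *)
exists t; apply/esym/eqP; rewrite eqEcard card_arrangement cS leqnn andbT.
apply/subsetP => _ /imsetP[[r c] _ ->].
suff -> : king t (r, c) = f (r, c) by case: (fP (r, c)).
by rewrite fE /king /= tnth_mktuple /= inE negbK kP.
Qed.

Lemma K_card : K n = #|[set t : n.-tuple row_state | sorted step t]|.
Proof.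
rewrite -(card_imset _ arrangement_inj); apply: eq_card => S; rewrite inE.
apply/andP/imsetP => [[na /eqP /(arrangement_surj _ na)[t St]]|[t]].
  by exists t; rewrite // inE sorted_arrangement -?St.
by rewrite inE => ts ->; rewrite nonattacking_arrangement ?card_arrangement.
Qed.

End Chains.

Theorem theorem1 (n : nat) (hn : 1 <= n) :
  K n = \sum_(A : {set 'I_n}) \sum_(1 <= k < n.+2) m n A k.
Proof.
(* As [n] is positive, a chain has a first row; summing over it leaves the paths that [m_card]
   counts. *)
rewrite K_card; case: n hn => // n _; rewrite card_cons_tuple.
under eq_bigr do rewrite -m_card.
rewrite -(pair_big predT predT (fun A (k : 'I_n.+2) => m n.+1 A k.+1)) /=.
by apply: eq_bigr => A _; rewrite big_add1 big_mkord.
Qed.
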